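(* Let $(V,d,\mu)$ be a probability metric space. Let $\mathcal{F}$ be the class of all $\mu$-integrable $1$-Lipschitz functions $f:V\to\mathbb{R}$, and let $\mathcal{F}^{\ast}\subset\mathcal{F}$ be the family of integrable distance functions of the form $f(u)=-d(A,u)$ with $A\subset V$ a nonempty measurable set. Then for every $x\in\mathbb{R}$, $$\sup_{f\in\mathcal{F}}\mu\{u\in V: f(u)-\mathbf{E}_{\mu} f\geq x\}=\sup_{f\in\mathcal{F}^{\ast}}\mu\{u\in V: f(u)-\mathbf{E}_{\mu} f\geq x\}.$$
   Context: A probability metric space $(V,d,\mu)$ is a metric space $(V,d)$ with a Borel measure $\mu$ normalized so that $\mu(V)=1$. A function $f:V\to\mathbb{R}$ is $1$-Lipschitz if $|f(u)-f(v)|\leq d(u,v)$ for all $u,v\in V$. $\mathbf{E}_{\mu} f=\int_V f\,d\mu$. For nonempty $A\subset V$ and $u\in V$, $d(A,u)=\inf_{a\in A} d(a,u)$. *)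

(* Defs.v *)
From HB Require Import structures.
From mathcomp Require Import all_boot all_order all_algebra.
From mathcomp Require Import all_classical all_reals all_analysis.

Set Implicit Arguments.
Unset Strict Implicit.
Unset Printing Implicit Defensive.

Import Order.TTheory GRing.Theory Num.Theory.
Import numFieldNormedType.Exports.

Local Open Scope classical_set_scope.
Local Open Scope ring_scope.

(* The library's measurable types are pointed, so the metric space must be too;
   a space that carries a probability measure is nonempty, hence nothing is
   lost. The distinguished point plays no other role. *)
#[short(type="pmetricType")]
HB.structure Definition PointedMetric (K : numDomainType) :=
  { M of Pointed M & Metric K M }.

(* V with the sigma-algebra generated by the open sets of its metric topology;
   the carrier is convertible to V. *)
Notation borel V := (g_sigma_algebraType (@open V)).

Section LipschitzFunctions.
Context {R : realType} {V : pmetricType R}.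

Definition lipschitz1 (f : V -> R) : Prop :=
  forall u v : V, `|f u - f v| <= mdist u v.

(* A real infimum, meaningful only for nonempty A. *)
Definition set_dist (A : set V) (u : V) : R := inf [set mdist a u | a in A].

Variable mu : probability (borel V) R.

Definition integrable_fun (f : V -> R) : Prop :=
  mu.-integrable [set: borel V] (EFin \o f).

Definition mean (f : V -> R) : R := (\int[mu]_u f u)%R.

Definition lip_class : set (V -> R) :=
  [set f | integrable_fun f /\ lipschitz1 f].

Definition dist_class : set (V -> R) :=
  [set f | integrable_fun f /\
    exists A : set (borel V),
      [/\ measurable A, A !=set0 & f = (fun u => - set_dist A u)]].

Definition upper_tail (x : R) (f : V -> R) : \bar R :=
  mu [set u | x <= f u - mean f].

End LipschitzFunctions.

(* Main.v *)
Require Import Defs.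
From mathcomp Require Import all_boot all_order all_algebra.
From mathcomp Require Import all_classical all_reals all_analysis.
From mathcomp Require Import measurable_realfun lra.

Import Order.TTheory GRing.Theory Num.Theory.
Import numFieldNormedType.Exports.

Local Open Scope classical_set_scope.
Local Open Scope ring_scope.

(** Distance functions are 1-Lipschitz, so only one inequality needs an
    argument: each tail of a Lipschitz function [f] must be dominated by a tail
    of some [- d(B, .)]. Let [m] be the mean of [f] and
    [A = {f - m >= x}]; assume [A] nonempty, the other case being trivial.

    Since [f >= m + x] on [A], the Lipschitz condition gives
    [f >= m + x - d(A, .)] everywhere, and integrating yields
    [x <= E d(A, .)] ([deviation_le_integral_set_dist]). The function
    [g = - d(A, .)] vanishes on [A] and has mean at most [- x], so
    [g - E g >= x] on [A]: its tail contains that of [f].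

    This argument needs [d(A, .)] to be integrable, which integrability of [f]
    does not ensure: [f] may be bounded while [V] has heavy tails. If
    [E d(A, .)] is infinite, [A] is enlarged by all points at distance at least
    [n] from it. The distance to this larger set is bounded by [n], hence
    integrable, and it equals [d(A, .)] wherever the latter is at most [n / 2],
    so its mean tends to infinity with [n] and eventually exceeds [x]
    ([integral_pad_divergent]). Any enlargement [B] of [A] with
    [x <= E d(B, .) < oo] serves as well as [A] itself, because [- d(B, .)]
    still vanishes on [A] ([upper_tail_le_dist_class]). *)

Section DistanceToSet.
Context {R : realType} {V : pmetricType R}.
Implicit Types (A B : set V) (u v : V).

Lemma set_dist_le A a u : A a -> set_dist A u <= mdist a u.
Proof.
move=> Aa; apply: ge_inf; last by exists a.
by exists 0 => _ [b _ <-]; exact: mdist_ge0.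
Qed.

Lemma le_set_dist A u c :
  A !=set0 -> (forall a, A a -> c <= mdist a u) -> c <= set_dist A u.
Proof.
move=> [a Aa] h; apply: lb_le_inf; first by exists (mdist a u), a.
by move=> _ [b Ab <-]; exact: h.
Qed.

Lemma set_dist_anti A B u :
  A !=set0 -> A `<=` B -> set_dist B u <= set_dist A u.
Proof. by move=> A0 AB; apply: le_set_dist => // a /AB; exact: set_dist_le. Qed.

Lemma set_dist_ge0 A u : A !=set0 -> 0 <= set_dist A u.
Proof. by move=> A0; apply: le_set_dist => // a _; exact: mdist_ge0. Qed.

Lemma set_dist_mem A u : A !=set0 -> A u -> set_dist A u = 0.
Proof.
move=> A0 Au; apply/eqP; rewrite eq_le set_dist_ge0// andbT.
by rewrite -(mdistxx u); exact: set_dist_le.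
Qed.

Lemma set_dist_triangle A u v :
  A !=set0 -> set_dist A u <= set_dist A v + mdist v u.
Proof.
move=> A0; rewrite -lerBlDr; apply: le_set_dist => // a Aa.
by rewrite lerBlDr; exact: le_trans (set_dist_le _ _ _ Aa) (metric_triangle _ _ _).
Qed.

Lemma lipschitz1N_set_dist A :
  A !=set0 -> lipschitz1 (fun u => - set_dist A u).
Proof.
move=> A0 u v.
have := set_dist_triangle A u v A0; have := set_dist_triangle A v u A0.
rewrite (metric_sym v u) ler_norml => ? ?; lra.
Qed.

(** Padding bounds the distance function by [r]; where [A] is much closer than
    [r], the added points are too far away to matter. *)
Definition pad A (r : R) : set V := A `|` [set u | r <= set_dist A u].

Lemma pad_nonempty A r : A !=set0 -> pad A r !=set0.
Proof. by move=> [a Aa]; exists a; left. Qed.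

Lemma sub_pad A r s : r <= s -> pad A s `<=` pad A r.
Proof. by move=> rs u [Au|/= su]; [left|right; exact: le_trans su]. Qed.

Lemma set_dist_pad_le A r u : A !=set0 -> 0 <= r -> set_dist (pad A r) u <= r.
Proof.
move=> A0 r0; have [ru|ur] := leP r (set_dist A u).
  by rewrite set_dist_mem//; [exact: pad_nonempty|right].
apply: le_trans (ltW ur); apply: set_dist_anti => // a Aa.
by left.
Qed.

Lemma set_dist_pad_id A r u : A !=set0 -> 2 * set_dist A u <= r ->
  set_dist (pad A r) u = set_dist A u.
Proof.
move=> A0 ur; apply/eqP; rewrite eq_le; apply/andP; split.
  by apply: set_dist_anti => // a Aa; left.
apply: le_set_dist => [|a [Aa|/= ra]]; first exact: pad_nonempty.
  exact: set_dist_le.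
(* Moving from u to a raises the distance to A from at most r/2 to at least r,
   so a lies at distance at least r/2 from u. *)
have := set_dist_triangle A a u A0; rewrite (metric_sym u a); lra.
Qed.

Lemma continuous_lipschitz1 (f : V -> R) : lipschitz1 f -> continuous f.
Proof.
move=> lf u; apply/cvgrPdist_lt => e e0; apply/nbhs_ballP; exists e => // v.
by rewrite ballEmdist; exact: le_lt_trans (lf u v).
Qed.

Lemma measurable_lipschitz1 (f : V -> R) :
  lipschitz1 f -> measurable_fun [set: borel V] f.
Proof.
move=> /continuous_lipschitz1/continuousP cf.
apply: (measurability _ (RGenOpens.measurableE R)).
move=> _ [_ [a [b ->] <-]]; rewrite setTI; apply: sub_sigma_algebra.
exact/cf/interval_open.
Qed.

Lemma measurable_set_dist A :
  A !=set0 -> measurable_fun [set: borel V] (set_dist A).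
Proof.
move=> /lipschitz1N_set_dist/measurable_lipschitz1 mN.
have -> : set_dist A = \- (fun u : borel V => - set_dist A u).
  by apply/funext => u; rewrite /= opprK.
exact: measurable_funN.
Qed.

Lemma measurable_superlevel (f : borel V -> R) (c : R) :
  measurable_fun setT f -> measurable [set u | c <= f u].
Proof.
by move=> mf; rewrite -[X in measurable X]setTI; exact: measurable_fun_ler.
Qed.

End DistanceToSet.

Section Mean.
Context {R : realType} {V : pmetricType R} (mu : probability (borel V) R).
Implicit Types A : set (borel V).

Lemma integrable_bounded (f : borel V -> R) (r : R) :
  measurable_fun setT f -> (forall u, 0 <= f u <= r) -> integrable_fun mu f.
Proof.
move=> mf fr; apply: measurable_bounded_integrable => //.
  by rewrite -ge0_fin_numE ?fin_num_measure.
exists r; split => [|s rs u _]; first exact: num_real.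
have /andP[f0 ur] := fr u; rewrite /= ger0_norm//; exact: le_trans (ltW rs).
Qed.

Lemma integrable_set_dist A : A !=set0 ->
  (\int[mu]_u (set_dist A u)%:E < +oo)%E -> integrable_fun mu (set_dist A).
Proof.
move=> A0 Afin; apply/integrableP; split.
  by apply/measurable_EFinP; exact: measurable_set_dist.
by under eq_integral => u _ do rewrite /= ger0_norm ?set_dist_ge0//.
Qed.

Lemma integrable_funN (f : V -> R) :
  integrable_fun mu f -> integrable_fun mu (fun u => - f u).
Proof. by move=> intf; exact: (integrableN intf). Qed.

(** The padded sets shrink as [n] grows, so their distance functions increase,
    and at each point they end up equal to [d(A, .)]: the monotone convergence
    theorem applies. *)
Lemma integral_pad_divergent A (c : R) : A !=set0 ->
  (\int[mu]_u (set_dist A u)%:E = +oo)%E ->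
  exists n, (c%:E <= \int[mu]_u (set_dist (pad A n%:R) u)%:E)%E.
Proof.
move=> A0 Aoo.
have pad0 n : pad A n%:R !=set0 by exact: pad_nonempty.
have lim_pad u : limn (fun n => (set_dist (pad A n%:R) u)%:E) =
    (set_dist A u)%:E.
  apply: lim_near_cst => //.
  near=> n; rewrite set_dist_pad_id//.
  near: n; exact: nbhs_infty_ger.
have : (\int[mu]_u (set_dist (pad A n%:R) u)%:E)%E @[n --> \oo] --> +oo%E.
  rewrite -Aoo; under [X in _ --> X]eq_integral do rewrite -lim_pad.
  apply: cvg_monotone_convergence => //.
  - by move=> n; apply/measurable_EFinP; exact: measurable_set_dist.
  - by move=> n u _; rewrite lee_fin set_dist_ge0.
  move=> u _ n m nm; rewrite lee_fin; apply: set_dist_anti => //.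
  by apply: sub_pad; rewrite ler_nat.
by move=> /cvgeyPge/(_ c)[n _ /(_ n (leqnn n)) cn]; exists n.
Unshelve. all: by end_near. Qed.

(** Replaces [A] by a set whose distance function is integrable, at no loss for
    a tail estimate: [B] still contains [A] and the mean distance stays at least
    [c]. *)
Lemma integrable_enlargement A (c : R) : measurable A -> A !=set0 ->
  (c%:E <= \int[mu]_u (set_dist A u)%:E)%E ->
  exists B : set (borel V), [/\ measurable B, A `<=` B,
    integrable_fun mu (set_dist B) & (c%:E <= \int[mu]_u (set_dist B u)%:E)%E].
Proof.
move=> mA A0 cA.
have mdA := measurable_set_dist _ A0.
have [Afin|] := ltP (\int[mu]_u (set_dist A u)%:E)%E +oo%E.
  by exists A; split => //; exact: integrable_set_dist.
rewrite leye_eq => /eqP /(integral_pad_divergent _ c A0)[n cn].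
have pad0 := @pad_nonempty R V A n%:R A0.
exists (pad A n%:R); split => //.
- by apply: measurableU => //; exact: measurable_superlevel.
- by move=> u; left.
- apply: (integrable_bounded _ n%:R); first exact: measurable_set_dist.
  by move=> u; rewrite set_dist_ge0// set_dist_pad_le.
Qed.

(** Averages the pointwise bound [f u >= x + mean f - d(A, u)], which is the
    Lipschitz condition between [u] and the points of [A]. The integral is taken
    in the extended reals because it may be infinite. *)
Lemma deviation_le_integral_set_dist (f : V -> R) (x : R) :
  lip_class mu f ->
  let A := [set u | x <= f u - mean mu f] in A !=set0 ->
  (x%:E <= \int[mu]_u (set_dist A u)%:E)%E.
Proof.
move=> [intf lf] A A0.
have [Afin|] := ltP (\int[mu]_u (set_dist A u)%:E)%E +oo%E; last first.
  by rewrite leye_eq => /eqP ->; rewrite leey.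
have intA := integrable_set_dist A A0 Afin.
have intc : integrable_fun mu (cst (x + mean mu f)).
  by apply: finite_measure_integrable_cst.
have : \int[mu]_u (x + mean mu f - set_dist A u) <= mean mu f.
  apply: le_Rintegral => //; first exact: (integrableB measurableT intc intA).
  move=> u _; rewrite lerBlDr -lerBlDl; apply: le_set_dist => // a /= Aa.
  have := lf a u; rewrite ler_norml; rewrite /A/= in Aa; lra.
rewrite RintegralB// Rintegral_cst// [X in fine X](_ : _ = 1%E); last first.
  exact: probability_setT.
rewrite mulr1 => xA.
rewrite -[leRHS]fineK; last exact: integrable_fin_num.
rewrite lee_fin; move: xA; rewrite /Rintegral; lra.
Qed.

Lemma mean_N_set_dist A : integrable_fun mu (set_dist A) ->
  mean mu (fun u => - set_dist A u) = - \int[mu]_u set_dist A u.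
Proof.
move=> intA; rewrite /mean.
under eq_Rintegral => u _ do rewrite -mulN1r.
by rewrite RintegralZl// mulN1r.
Qed.

Lemma dist_class_sub_lip_class : dist_class mu `<=` lip_class mu.
Proof.
move=> f [intf [A [_ A0 fE]]]; split => //.
by rewrite fE; exact: lipschitz1N_set_dist.
Qed.

(** The supremum over distance functions must be compared with zero when no
    point reaches the deviation [x]; the distance to the whole space is a
    witness. *)
Lemma exists_dist_class : dist_class mu !=set0.
Proof.
have T0 : [set: V] !=set0 by exists point.
exists (fun u => - set_dist setT u); split; last by exists setT.
apply/integrable_funN/(integrable_bounded _ 0); first exact: measurable_set_dist.
by move=> u; rewrite set_dist_mem// lexx.
Qed.

(** With [B] an enlargement of [{f - mean f >= x}] as above and [g = - d(B, .)],
    the superlevel set of [f] is contained in that of [g], because [g]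
    vanishes on [B] and its mean is at most [- x]. *)
Lemma upper_tail_le_dist_class (f : V -> R) (x : R) : lip_class mu f ->
  exists2 g, dist_class mu g & (upper_tail mu x f <= upper_tail mu x g)%E.
Proof.
move=> Ff; have [intf lf] := Ff.
pose A : set (borel V) := [set u | x <= f u - mean mu f].
have mA : measurable A.
  apply: (measurable_superlevel (fun u => f u - mean mu f)).
  by apply: measurable_funB => //; exact: measurable_lipschitz1.
have [A0|/set0P A0] := eqVneq A set0.
  have [g Fg] := exists_dist_class; exists g => //.
  by rewrite /upper_tail -/A A0 measure0.
have := deviation_le_integral_set_dist f x Ff A0.
move=> /(integrable_enlargement _ _ mA A0)[B [mB AB intB xB]].
have B0 : B !=set0 by have [a /AB] := A0; exists a.
have intN := integrable_funN _ intB.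
exists (fun u => - set_dist B u); first by split=> //; exists B.
apply: le_measure.
- by rewrite inE.
- rewrite inE; apply: (measurable_superlevel
    (fun u => - set_dist B u - mean mu (fun u => - set_dist B u))).
  apply: measurable_funB => //; apply: measurable_lipschitz1.
  exact: lipschitz1N_set_dist.
move=> u /AB Bu /=; rewrite set_dist_mem// mean_N_set_dist// oppr0 sub0r opprK.
by rewrite -lee_fin /Rintegral fineK//; exact: integrable_fin_num.
Qed.

End Mean.

Theorem theorem1 (R : realType) (V : pmetricType R)
    (mu : probability (borel V) R) (x : R) :
  ereal_sup [set upper_tail mu x f | f in lip_class mu] =
  ereal_sup [set upper_tail mu x f | f in dist_class mu].
Proof.
apply/eqP; rewrite eq_le; apply/andP; split.
  apply/ereal_supP => _ [f Ff <-]; apply: le_ereal_sup_tmp.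
  have [g Fg fg] := upper_tail_le_dist_class mu f x Ff.
  by exists (upper_tail mu x g) => //; exists g.
by apply: ereal_sup_le; apply: image_subset; exact: dist_class_sub_lip_class.
Qed.
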